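(* There exist a function $g:[0,1]\to\mathbb{R}$ with $g\in C^1[0,1]$ that is not constant on any positive mass subset of $[0,1]$, and a positive mass set $X\subset[0,1]$, such that $\lambda(g(X))=0$.
   Context: $\lambda$ denotes Lebesgue measure on $\mathbb{R}$; a positive mass set is a Lebesgue measurable set of positive Lebesgue measure. *)

(* Defs.v *)
From HB Require Import structures.
From mathcomp Require Import all_boot all_order all_algebra.
From mathcomp Require Import all_classical all_reals all_analysis.

Set Implicit Arguments.
Unset Strict Implicit.
Unset Printing Implicit Defensive.

Import Order.TTheory GRing.Theory Num.Theory.
Import numFieldNormedType.Exports.
Local Open Scope classical_set_scope.
Local Open Scope ring_scope.

(* Lebesgue (not just Borel) measurability: membership in the sigma-algebra on
   which [completed_lebesgue_measure] is a measure, namely the Caratheodory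
   sigma-algebra of the Lebesgue outer measure; by
   [completed_caratheodory_measurable] it is the completion of the Borel sets.
   [completed_lebesgue_measure A] is the outer measure of [A] when [A] is not
   in it, so measurability has to be stated separately. *)
Definition lebesgue_measurable (R : realType) (A : set R) : Prop :=
  (((wlength (R := R) idfun)^*)%mu).-cara.-measurable A.

Definition positive_mass (R : realType) (A : set R) : Prop :=
  lebesgue_measurable A /\ (0%:E < completed_lebesgue_measure A)%E.

(* The difference quotient is only taken at points of [a, b] other than x, so
   that the derivative is one-sided at the endpoints and values of g outside
   [a, b] are irrelevant. *)
Definition has_derivative_within (R : realType) (a b : R) (g : R -> R)
    (x l : R) : Prop :=
  (fun y => (g y - g x) / (y - x)) @ within `[a, b] x^' --> l.

Definition C1_on (R : realType) (a b : R) (g : R -> R) : Prop :=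
  exists2 g' : R -> R,
    {in `[a, b], forall x, has_derivative_within a b g x (g' x)} &
    {within `[a, b], continuous g'}.

Definition constant_on (R : realType) (A : set R) (g : R -> R) : Prop :=
  exists c : R, forall x : R, A x -> g x = c.

(* Main.v *)
Require Import Defs.
From mathcomp Require Import all_boot all_order all_algebra.
From mathcomp Require Import all_classical all_reals all_analysis.
From mathcomp Require Import ring lra.
Import Order.TTheory GRing.Theory Num.Theory.
Import numFieldNormedType.Exports.
Local Open Scope classical_set_scope.
Local Open Scope ring_scope.

(** Take a compact set [K] of irrational numbers in [[0, 1]] of positive measure,
    and let [g] be a primitive of the distance function to [K]. As the complement
    of [K] is dense, [g] is strictly increasing, hence constant on no set with two
    points. For [x] in [K] the derivative at [t] is at most [|t - x|], so that
    [|g x - g y| <= (x - y)^2]; cutting [[0, 1]] into [n] intervals of length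
    [1/n] then covers [g(K)] by about [n] intervals of length [2/n^2], whence
    [g(K)] is null. *)

(* [inf set0 = 0], so [dist set0] is identically 0. *)
Definition dist {R : realType} (K : set R) (x : R) : R :=
  inf [set `|x - k| | k in K].

Lemma dist_le {R : realType} (K : set R) (x k : R) : K k -> dist K x <= `|x - k|.
Proof.
move=> Kk; apply: ge_inf; last by exists k.
by exists 0 => _ [j _ <-].
Qed.

Lemma le_dist {R : realType} (K : set R) (x e : R) : K !=set0 ->
  (forall k, K k -> e <= `|x - k|) -> e <= dist K x.
Proof.
move=> [k Kk] eK; apply: lb_le_inf; first by exists `|x - k|, k.
by move=> _ [j Kj <-]; exact: eK.
Qed.

Lemma dist_ge0 {R : realType} (K : set R) (x : R) : K !=set0 -> 0 <= dist K x.
Proof. by move=> K0; apply: le_dist. Qed.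

(** Some ball around [x] misses [K], and its radius bounds all the distances from below. This makes
    the derivative of [g] positive off [K]. *)
Lemma dist_gt0 {R : realType} (K : set R) (x : R) : closed K -> K !=set0 ->
  ~ K x -> 0 < dist K x.
Proof.
move=> Kcl K0 nKx.
have /nbhs_ballP[e /= e0 xeK] : nbhs x (~` K).
  by apply: open_nbhs_nbhs; split => //; exact: closed_openC.
apply: (lt_le_trans e0); apply: le_dist => // k Kk.
by rewrite leNgt; apply/negP => xke; exact: (xeK k).
Qed.

(** By the triangle inequality, [dist K x - |x - y|] is a lower bound of the distances from [y] to
    [K]. Exchanging [x] and [y] gives the other half of the Lipschitz bound. *)
Lemma dist_lipschitz {R : realType} (K : set R) (x y : R) : K !=set0 ->
  dist K x - dist K y <= `|x - y|.
Proof.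
move=> K0; rewrite lerBlDl -lerBlDr; apply: le_dist => // k Kk.
rewrite lerBlDr (le_trans (dist_le K x k Kk))//.
by rewrite [in leRHS]addrC -[x - k](subrKA y) ler_normD.
Qed.

Lemma continuous_dist {R : realType} (K : set R) : K !=set0 ->
  continuous (dist K).
Proof.
move=> K0 x; apply/cvgrPdist_le => e e0; near=> y.
have xye : `|x - y| <= e by near: y; exact: cvgr_dist_le.
rewrite ler_norml lerNl opprB; apply/andP; split.
  by rewrite (le_trans (dist_lipschitz K y x K0))// distrC.
by rewrite (le_trans (dist_lipschitz K x y K0)).
Unshelve. all: by end_near. Qed.

Lemma continuous_primitive {R : realType} (f : R -> R) (a b : R) :
  continuous f ->
  exists F : R -> R, forall x, a < x < b -> is_derive x 1 F (f x).
Proof.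
move=> fc; exists (fun x => \int[lebesgue_measure]_(t in `[a, x]) f t).
move=> x /andP[ax xb].
have intf : lebesgue_measure.-integrable `[a, b] (EFin \o f).
  apply: continuous_compact_integrable; first exact: segment_compact.
  exact: continuous_subspaceT.
have [dF F'x] := continuous_FTC1_closed xb intf ax (fc x).
by rewrite -F'x derive1E; exact: derivableP.
Qed.

(** Caratheodory's form [g y - g x = h y * (y - x)], with [h] continuous at [x], identifies the
    difference quotient with [h] away from [x]. *)
Lemma is_derive_within {R : realType} (a b x l : R) (g : R -> R) :
  is_derive x 1 g l -> has_derivative_within a b g x l.
Proof.
move=> /is_derive1_caratheodory[h [gh hx <-]].
apply: cvg_within_filter.
suff gE : {near x^', h =1 (fun y => (g y - g x) / (y - x))}.
  apply: cvg_trans (near_eq_cvg gE) _.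
  exact: cvg_within_filter hx.
near=> y; rewrite gh mulfK// subr_eq0.
by near: y; exact: nbhs_dnbhs_neq.
Unshelve. all: by end_near. Qed.

Lemma quadratic_image_null {R : realType} (K : set R) (g : R -> R) :
  K `<=` `[0, 1] ->
  (forall x y, K x -> `[0, 1]%classic y -> `|g x - g y| <= (x - y) ^+ 2) ->
  measurable (g @` K : set (measurableTypeR R)) ->
  lebesgue_measure (g @` K) = 0%E.
Proof.
move=> K01 gK mgK; apply/eqP; rewrite eq_le measure_ge0 andbT.
apply/lee_addgt0Pr => e e0; rewrite add0e.
pose n := Num.truncn (4 / e); pose N : R := n.+1%:R.
have N0 : 0 < N by rewrite ltr0n.
have N1 : 1 <= N by rewrite ler1n.
have Ne : 4 / N <= e.
  by rewrite ler_pdivrMr// mulrC -ler_pdivrMr// ltW// truncnS_gt.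
pose I (i : nat) : set (measurableTypeR R) :=
  `[g (i%:R / N) - N^-1 ^+ 2, g (i%:R / N) + N^-1 ^+ 2]%classic.
(* With [i] the integer part of [x * N], the point [i / N] is within [1 / N] of [x]. The index
   [i = N] occurs when [x = 1], hence [N + 1 = n.+2] intervals. Their centres [g (i / N)] need not
   lie in the image of [K]. *)
have cover : g @` K `<=` \big[setU/set0]_(i < n.+2) I i.
  move=> _ [x Kx <-]; have /= := K01 _ Kx; rewrite in_itv/= => /andP[x0 x1].
  have /andP[] := truncn_itv (mulr_ge0 x0 (ltW N0)).
  set i := Num.truncn _ => ix xi.
  have iN : i%:R <= N by rewrite (le_trans ix)// ler_piMl// ltW.
  rewrite -bigcup_mkord; exists i => /=; first by rewrite ltnS -(ler_nat R).
  rewrite /I/= in_itv/= -ler_distl.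
  have iN01 : `[0, 1]%classic (i%:R / N).
    by rewrite /= in_itv/= divr_ge0 ?(ltW N0)//= ler_pdivrMr// mul1r.
  have d0 : 0 <= x - i%:R / N by rewrite subr_ge0 ler_pdivrMr.
  have d1 : x - i%:R / N <= N^-1.
    rewrite lerBlDr -[X in X + _]mul1r -mulrDl nat1r ler_pdivlMr//; exact: ltW.
  by rewrite (le_trans (gK _ _ Kx iN01))// ler_sqr ?nnegrE// (le_trans d0).
have mI i : (i < n.+2)%N -> measurable (I i) by move=> _; exact: measurable_itv.
have := @content_subadditive _ _ _ lebesgue_measure _ _ n.+2 mI mgK cover.
move=> /le_trans; apply.
rewrite (_ : (\sum_(i < n.+2) _)%E =
             (\sum_(i < n.+2) (2 * N^-1 ^+ 2)%:E)%E); last first.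
  apply: eq_bigr => i _; rewrite /= /I lebesgue_measure_itv/= lte_fin.
  rewrite ltrD2l gtrN ?exprn_gt0 ?invr_gt0//.
  by rewrite -EFinB; congr EFin; ring.
(* The total length is [2 * (N + 1) / N ^ 2], at most [4 / N] because [1 <= N]. *)
rewrite sumEFin lee_fin (le_trans _ Ne)// sumr_const card_ord.
rewrite -[leLHS]mulr_natr.
have -> : n.+2%:R = N + 1 by rewrite /N -natr1.
rewrite -[4 / N](_ : 4 * N * N^-1 ^+ 2 = _); last by field; rewrite gt_eqF.
rewrite [leLHS](_ : _ = 2 * (N + 1) * N^-1 ^+ 2); last by ring.
by rewrite ler_wpM2r ?exprn_ge0 ?invr_ge0 ?(ltW N0)//; lra.
Qed.

Lemma measurable_lebesgue_measurable {R : realType} (A : set R) :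
  measurable (A : set (measurableTypeR R)) -> lebesgue_measurable A.
Proof. exact: sub_caratheodory. Qed.

Lemma positive_mass_not_subset1 {R : realType} (A : set R) (a : R) :
  positive_mass A -> ~ A `<=` [set a].
Proof.
move=> [_ A0] Aa; move: A0; apply/negP; rewrite -leNgt.
rewrite -[leRHS](lebesgue_measure_set1 a).
exact: le_outer_measure.
Qed.

(** The rationals are null, so the irrationals of [[0, 1]] have measure 1. Inner regularity with
    error 1 gives a compact [K] inside them; were [K] null, the remainder would have measure 1, not
    less. *)
Lemma compact_irrational_positive (R : realType) : exists K : set R,
  [/\ compact K, K `<=` `[0, 1],
      (forall q : rat, ~ K (ratr q)) & (0 < lebesgue_measure K)%E].
Proof.
pose Q : set (measurableTypeR R) := range ratr.
pose D : set (measurableTypeR R) := `[0, 1]%classic `\` Q.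
have mQ : measurable Q.
  apply: countable_measurable; first by move=> t; exact: measurable_set1.
  exact: card_le_trans (card_image_le _ _) (countableP _).
have mD : measurable D by exact: measurableD.
have D1 : lebesgue_measure D = 1%E.
  rewrite -[RHS](_ : lebesgue_measure `[0%R : R, 1%R] = 1%E); last first.
    by rewrite lebesgue_measure_itv/= lte_fin ltr01 oppr0 adde0.
  rewrite [RHS](measureDI _ _ mQ)//.
  rewrite [X in _ = (_ + X)%E](@subset_measure0 _ _ _ _ _ Q) ?adde0//.
  - exact: measurableI.
  - exact: lebesgue_measure_rat.
have Dfin : (lebesgue_measure D < +oo)%E by rewrite D1 ltry.
have [K [cK KD DK]] := lebesgue_regularity_inner mD Dfin ltr01.
exists K; split => //.
- by move=> x /KD[].
- by move=> q /KD[_]; apply; exists q.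
rewrite lt0e measure_ge0 andbT; apply/eqP => K0.
have mK : measurable (K : set (measurableTypeR R)).
  exact: measurable_realfun.compact_measurable.
have DK0 : lebesgue_measure (D `&` K) = 0%E.
  by apply: (subset_measure0 _ mK _ K0) => //; exact: measurableI.
move: DK; have := measureDI lebesgue_measure mD mK.
by rewrite /= DK0 adde0 D1 => <-; rewrite ltxx.
Qed.

Theorem mainTheorem2 (R : realType) :
  exists g : R -> R,
    [/\ C1_on 0 1 g,
        (forall A : set R, A `<=` `[0, 1] -> positive_mass A ->
           ~ constant_on A g) &
        exists X : set R,
          [/\ X `<=` `[0, 1],
              positive_mass X,
              lebesgue_measurable (g @` X) &
              completed_lebesgue_measure (g @` X) = 0%E]].
Proof.
have [K [cK K01 KQ mK]] := compact_irrational_positive R.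
have clK : closed K by apply: compact_closed => //; exact: Rhausdorff.
have K0 : K !=set0.
  by apply/set0P/eqP => K0; move: mK; rewrite K0 measure0 ltxx.
(* The interval []-1, 2[] has 0 and 1 in its interior, so [g] has two-sided derivatives there as
   well. *)
have [g dg] := continuous_primitive (dist K) (-1) 2 (continuous_dist K K0).
have dg01 (x : R) : x \in `[0, 1] -> is_derive x 1 g (dist K x).
  by rewrite in_itv/= => /andP[x0 x1]; apply: dg; apply/andP; split; lra.
have cg : {within `[0, 1], continuous g}.
  by apply: derivable_within_continuous => x /dg01 [].
have gMVT (x y : R) : 0 <= x -> x <= y -> y <= 1 ->
    exists2 c, c \in `[x, y]%R & g y - g x = dist K c * (y - x).
  move=> x0 xy y1; have sub : `[x, y]%classic `<=` `[0, 1].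
    by apply: subset_itv; rewrite bnd_simp.
  have cgxy : {within `[x, y], continuous g} by exact: (continuous_subspaceW sub cg).
  have dgxy z : z \in `]x, y[ -> is_derive z 1 g (dist K z).
    by move=> /subset_itv_oo_cc/sub/dg01.
  exact: (@MVT_segment R g (dist K) x y xy dgxy cgxy).
have g_le (x y : R) : 0 <= x -> x <= y -> y <= 1 -> g x <= g y.
  move=> x0 xy y1; have [c _ gxy] := gMVT _ _ x0 xy y1.
  by rewrite -subr_ge0 gxy mulr_ge0 ?dist_ge0 ?subr_ge0.
have g_lt (x y : R) : 0 <= x -> x < y -> y <= 1 -> g x < g y.
  move=> x0 xy y1.
  (* [g' > 0] on a segment starting at a rational point of []x, y[] *)
  have [q] := rat_in_itvoo xy; rewrite in_itv/= => /andP[xq qy].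
  have /nbhs_ballP[e /= e0 qe] : \forall z \near (ratr q : R), ~ K z /\ z < y.
    apply: filterI; last exact: lt_nbhsl.
    by apply: open_nbhs_nbhs; split; [exact: closed_openC|exact: KQ].
  (* Halving [e] keeps the closed segment from [ratr q] to [u] inside the ball; the mean value point
     may be an endpoint. *)
  pose u := ratr q + e / 2.
  have e20 : 0 < e / 2 by rewrite divr_gt0.
  have qzu z : ratr q <= z -> z <= u -> ~ K z /\ z < y.
    move=> qz zu; apply: qe; rewrite /ball/= distrC ger0_norm ?subr_ge0//.
    by move: zu; rewrite /u; lra.
  have qu : ratr q < u by rewrite ltrDl.
  have [_ uy] := qzu u (ltW qu) (lexx u).
  have [||//|c + gqu] := gMVT (ratr q) u; [lra|lra|lra|].
  rewrite in_itv/= => /andP[qc cu]; have [nKc _] := qzu _ qc cu.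
  apply: (le_lt_trans (g_le _ _ x0 (ltW xq) _)); first lra.
  apply: (@lt_le_trans _ _ (g u)); last by apply: g_le; lra.
  by rewrite -subr_gt0 gqu mulr_gt0 ?subr_gt0//; exact: dist_gt0.
have g_inj (x y : R) : x \in `[0, 1] -> y \in `[0, 1] -> g x = g y -> x = y.
  rewrite !in_itv/= => /andP[x0 x1] /andP[y0 y1] gxy.
  case: (ltgtP x y) => // [xy|yx].
    by have := g_lt _ _ x0 xy y1; rewrite gxy ltxx.
  by have := g_lt _ _ y0 yx x1; rewrite gxy ltxx.
have g_quad (x y : R) : K x -> `[0, 1]%classic y ->
    `|g x - g y| <= (x - y) ^+ 2.
  move=> Kx; have := K01 _ Kx; rewrite /= !in_itv/= => /andP[x0 x1] /andP[y0 y1].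
  (* In either order the mean value point [c] lies between [x] and [y], so
     [dist K c <= |c - x| <= |x - y|]. *)
  have [xy|/ltW yx] := leP x y.
    have [c + gxy] := gMVT _ _ x0 xy y1; rewrite in_itv/= => /andP[xc cy].
    rewrite distrC gxy ger0_norm ?mulr_ge0 ?dist_ge0 ?subr_ge0//.
    rewrite -sqrrN opprB expr2 ler_wpM2r ?subr_ge0// (le_trans (dist_le K c x Kx))//.
    by rewrite ger0_norm ?subr_ge0// lerD2r.
  have [c + gyx] := gMVT _ _ y0 yx x1; rewrite in_itv/= => /andP[yc cx].
  rewrite gyx ger0_norm ?mulr_ge0 ?dist_ge0 ?subr_ge0//.
  rewrite expr2 ler_wpM2r ?subr_ge0// (le_trans (dist_le K c x Kx))//.
  by rewrite distrC ger0_norm ?subr_ge0// lerD2l lerN2.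
have mgK : measurable (g @` K : set (measurableTypeR R)).
  apply: measurable_realfun.compact_measurable; apply: continuous_compact cK.
  exact: (continuous_subspaceW K01 cg).
exists g; split.
- exists (dist K); first by move=> x /dg01; exact: is_derive_within.
  exact: continuous_subspaceT (continuous_dist K K0).
- move=> A A01 Apos [c gc].
  (* Injectivity confines [A] to a single point [a], which has measure zero. The empty case is
     excluded by the same lemma, at the arbitrary point 0. *)
  have [a Aa] : A !=set0.
    apply/set0P/eqP => A0; apply: (positive_mass_not_subset1 A 0 Apos).
    by rewrite A0.
  apply: (positive_mass_not_subset1 A a Apos) => x Ax.
  by apply: g_inj; [exact: A01|exact: A01|rewrite !gc].
- exists K; split => //.
  + split=> //; apply: measurable_lebesgue_measurable.
    exact: measurable_realfun.compact_measurable.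
  + exact: measurable_lebesgue_measurable.
  (* [lebesgue_measure] and [completed_lebesgue_measure] are both given by the Lebesgue outer
     measure, so the two equations agree by conversion. *)
  + exact: quadratic_image_null.
Qed.
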